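(* Let $G$ be a finite group with generating set $\Sigma$ such that $\mathrm{Cay}(G,\Sigma)$ is geodetic but is neither a complete graph nor a cycle of odd length. Let $m$ be the number of disjoint cliques into which the neighborhood of $1\in G$ is partitioned. Then for all integers $z_0$ with $1\le z_0\le |Z(G)|$ and all integers $m_0$ with $3\le m_0\le m$, setting $\alpha_0=\frac{3m_0-4}{2m_0-2}$, the following inequality holds: $$\tfrac12\,\alpha_0\, z_0\,|\Sigma|^2 - z_0(z_0-2)\,|\Sigma| + \tfrac12\, z_0(z_0+1)\ \le\ |G|.$$
   Context: All generating sets $\Sigma\subseteq G$ satisfy $1\notin\Sigma$ and $\Sigma=\Sigma^{-1}$. The (undirected, simple) Cayley graph $\mathrm{Cay}(G,\Sigma)$ has vertex set $G$ and edge set $\{\{g,ga\} : g\in G,\ a\in\Sigma\}$. A connected graph is geodetic if for each pair of vertices there is a unique shortest path connecting them. In a geodetic graph, adjacency is transitive among distinct neighbors of a fixed vertex $v$, so the neighborhood of $v$ is a disjoint union of maximal cliques (the connected components of the subgraph induced on the neighbors of $v$, which does not contain $v$); $m$ is the number of these for $v=1$. *)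

(* Defs.v *)
From mathcomp Require Import all_boot all_order all_algebra all_fingroup all_solvable.
Set Implicit Arguments.
Unset Strict Implicit.
Unset Printing Implicit Defensive.

(* A simple graph on a finType T is given by its adjacency relation, a
   symmetric irreflexive e : rel T.  As in the path library, a walk from x to y
   is a seq p with path e x p and last x p = y: p omits x, so size p is its
   length. *)

Section Graphs.

Variable T : finType.
Implicit Types (e : rel T) (x y : T) (p : seq T) (A : {set T}).

Definition walk e x y p : Prop := path e x p /\ last x p = y.

Definition shortest_path e x y p : Prop :=
  walk e x y p /\ forall q, walk e x y q -> size p <= size q.

Definition connected_graph e : Prop := forall x y, connect e x y.

Definition geodetic e : Prop :=
  connected_graph e /\ forall x y, exists! p, shortest_path e x y p.

Definition complete_graph e : Prop := forall x y, e x y = (x != y).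

(* Isomorphism with the cycle on the residues 0, ..., n-1; ordS is the
   successor modulo n. *)
Definition cycle_graph n e : Prop :=
  3 <= n /\ exists f : 'I_n -> T, bijective f /\
    forall i j, e (f i) (f j) = (j == ordS i) || (i == ordS j).

Definition odd_cycle_graph e : Prop := exists n, odd n /\ cycle_graph n e.

Definition neighborhood e x : {set T} := [set y | e x y].

Definition induced e A : rel T := [rel x y | [&& x \in A, y \in A & e x y]].

(* Vertices outside A are isolated in induced e A, so A is closed under it and
   n_comp counts exactly the components of the subgraph induced on A. *)
Definition num_components e A : nat := n_comp (induced e A) A.

(* When e is geodetic, the components of the subgraph induced on the neighbors
   of x are the cliques that partition them. *)
Definition num_cliques_at e x : nat := num_components e (neighborhood e x).

End Graphs.

(* The adjacency relation is symmetric when S is closed under inverses, and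
   irreflexive when 1 is not in S. *)
Definition cayley (gT : finGroupType) (S : {set gT}) : rel gT :=
  [rel g h | [exists a in S, h == (g * a)%g]].

(* Main.v *)
(* Let d be the graph distance, len g = d(1, g), s = |Sigma|.

   Counting the ball of radius 2.  A product b c of two generators has length
   at most 1 exactly when c lies in the clique of b^-1 in the neighborhood of 1,
   so by uniqueness of geodesics the ball of radius 2 has at least
   1 + s + s^2 - K points, where K is the sum of the squares of the clique
   sizes.  Each clique together with 1 has an equidistant vertex: otherwise every
   vertex of G has a unique nearest point in it and each of its vertices is a cut
   vertex, which is impossible at maximal distance from a given vertex.  From an
   equidistant vertex closest to the clique, the geodesics to its points start in
   distinct cliques, so each clique has at most m - 1 elements, and convexity
   bounds K.

   Translating it by the center.  A central element z has a constant geodesic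
   word a^k, because the cyclic rotations of its geodesic word are again geodesic
   words of z.  Neither k = 1 (the generators would lie in two cliques) nor k = 2
   is possible, and for k >= 3 the balls of radius 2 around 1 and z share at most
   2s - 1 points.  Inclusion-exclusion over z0 central elements gives the bound. *)
Require Import Defs.
From mathcomp Require Import all_boot all_order all_algebra all_fingroup all_solvable.
From mathcomp Require Import zify ring lra.
Set Implicit Arguments.
Unset Strict Implicit.
Unset Printing Implicit Defensive.
Import Order.TTheory GRing.Theory Num.Theory.

(** * Geodetic graphs *)

(** A path-free form of geodeticity: [gm_next] provides a first step of a geodesic and [gm_uniq]
    makes it unique. *)
Record geodetic_metric (T : finType) (e : rel T) (d : T -> T -> nat) : Prop :=
  GeodeticMetric {
    gm_eq0 : forall x y, (d x y == 0) = (x == y);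
    gm_step : forall x x' y, e x x' -> d x y <= (d x' y).+1;
    gm_next : forall x y, x != y -> exists2 x', e x x' & d x y = (d x' y).+1;
    gm_uniq : forall x y x1 x2, e x x1 -> e x x2 ->
      d x y = (d x1 y).+1 -> d x y = (d x2 y).+1 -> x1 = x2 }.

Lemma geodetic_metric_exists (T : finType) (e : rel T) :
  geodetic e -> exists d, geodetic_metric e d.
Proof.
move=> [conn uniq].
pose walkb x y n := [exists p : n.-tuple T, path e x p && (last x p == y)].
have walkbP x y n : reflect (exists2 p, walk e x y p & size p = n) (walkb x y n).
  apply: (iffP existsP) => [[p /andP[pP /eqP lP]]|[p [pP lP] sp]].
    by exists p; rewrite ?size_tuple.
  have sp' : size p == n by apply/eqP.
  by exists (Tuple sp'); rewrite /= pP lP eqxx.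
have ex x y : exists n, walkb x y n.
  by have /connectP[p pP lP] := conn x y; exists (size p); apply/walkbP; exists p.
pose d x y := ex_minn (ex x y).
have dP x y : exists2 p, shortest_path e x y p & size p = d x y.
  rewrite /d; case: ex_minnP => n /walkbP[p wp sp] minn; exists p => //.
  by split=> // q wq; rewrite sp; apply: minn; apply/walkbP; exists q.
have dle x y p : walk e x y p -> d x y <= size p.
  by move=> wp; rewrite /d; case: ex_minnP => n _; apply; apply/walkbP; exists p.
have stepP x x' y p : e x x' -> walk e x' y p -> walk e x y (x' :: p).
  by move=> exx' [pP lP]; split; rewrite /= ?exx'.
exists d; split.
- move=> x y; apply/eqP/eqP => [d0|->].
    have [p [[_ lP] _] sp] := dP x y.
    by move: sp lP; rewrite d0; case: p.
  by have := @dle y y [::] (conj isT erefl); rewrite leqn0 => /eqP.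
- move=> x x' y exx'; have [p [wp _] <-] := dP x' y.
  exact: (dle x y (x' :: p) (stepP _ _ _ _ exx' wp)).
- move=> x y nxy; have [[|x' p] [[pP lP] minp] sp] := dP x y.
    by case/eqP: nxy.
  move: pP lP => /= /andP[exx' pP] lP.
  exists x' => //; apply/eqP; rewrite eqn_leq -sp /= ltnS; apply/andP; split.
    have [q [wq _] <-] := dP x' y.
    by have := minp _ (stepP _ _ _ _ exx' wq).
  by apply: dle.
- move=> x y x1 x2 e1 e2 d1 d2.
  have [p1 [w1 _] s1] := dP x1 y; have [p2 [w2 _] s2] := dP x2 y.
  have [p0 [_ up]] := uniq x y.
  have sh q : walk e x y q -> size q = d x y -> shortest_path e x y q.
    by move=> wq sq; split=> // r wr; rewrite sq; apply: dle.
  have E1 := up _ (sh _ (stepP _ _ _ _ e1 w1) (etrans (congr1 S s1) (esym d1))).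
  have E2 := up _ (sh _ (stepP _ _ _ _ e2 w2) (etrans (congr1 S s2) (esym d2))).
  by have := etrans (esym E1) E2; case.
Qed.

Section Graph.

Variables (T : finType) (e : rel T) (d : T -> T -> nat).
Hypothesis (gm : geodetic_metric e d) (e_sym : symmetric e) (e_irr : irreflexive e).
Implicit Types (x y v w k : T) (K : {set T}).

Lemma gm_adj x y : d x y = 1 -> e x y.
Proof.
move=> d1; have nxy : x != y by rewrite -(gm_eq0 gm) d1.
have [x' exx'] := gm_next gm nxy; rewrite d1 => -[/esym/eqP].
by rewrite (gm_eq0 gm) => /eqP <-.
Qed.

Lemma gm_diag x : d x x = 0.
Proof. by apply/eqP; rewrite (gm_eq0 gm). Qed.

Lemma gm_adjE x y : e x y -> d x y = 1.
Proof.
move=> exy; have := gm_step gm y exy; rewrite gm_diag.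
have : d x y != 0 by rewrite (gm_eq0 gm); apply/eqP => E; rewrite E e_irr in exy.
by case: (d x y) => [|[]].
Qed.

Lemma gm_triangle_adj x y y' : e y y' -> d x y' <= (d x y).+1.
Proof.
move: {2}(d x y) (leqnn (d x y)) => n; elim: n x => [|n IH] x.
  rewrite leqn0 (gm_eq0 gm) => /eqP -> eyy'; by rewrite (gm_adjE eyy') gm_diag.
move=> le eyy'; have [->|nxy] := eqVneq x y; first by rewrite (gm_adjE eyy') gm_diag.
have [x' exx' E] := gm_next gm nxy.
have := gm_step gm y' exx'; have := IH x' ltac:(lia) eyy'; lia.
Qed.

Lemma gm_sym x y : d x y = d y x.
Proof.
suff H u v : d u v <= d v u by apply/eqP; rewrite eqn_leq !H.
move: {2}(d v u) (leqnn (d v u)) => n; elim: n v => [|n IH] v.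
  by rewrite leqn0 (gm_eq0 gm) => /eqP ->; rewrite gm_diag.
have [->|nxy] := eqVneq v u; first by rewrite !gm_diag.
have [v' evv' E] := gm_next gm nxy.
move=> le; have := IH v' ltac:(lia).
rewrite e_sym in evv'; have := gm_triangle_adj u evv'; lia.
Qed.

(** Otherwise [x] and [w] are at distance 2 with two midpoints [v] and [y]. *)
Lemma gm_adj_trans v x y w : e v x -> e v y -> e v w -> e x y -> e y w ->
  x != w -> e x w.
Proof.
move=> evx evy evw exy eyw nxw.
have dle : d x w <= 2 by have := gm_step gm w exy; rewrite (gm_adjE eyw).
have : d x w != 0 by rewrite (gm_eq0 gm).
case E : (d x w) dle => [|[|[|//]]] // _ _; first exact: gm_adj.
have := @gm_uniq _ _ _ gm x w v y; rewrite e_sym evx exy E !gm_adjE // => vy.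
by rewrite (vy isT isT erefl erefl) e_irr in evy.
Qed.

(* A clique containing every vertex with two neighbours in it. *)
Definition closed_clique K : Prop :=
  {in K &, forall k k', k != k' -> e k k'} /\
  forall v k k', k \in K -> k' \in K -> k != k' -> e v k -> e v k' -> v \in K.

(** * Nearest points in a clique and equidistant vertices *)

Section Clique.

Variable K : {set T}.
Hypothesis clK : closed_clique K.

Definition nearest x k := forall k', k' \in K -> k' != k -> d x k' = (d x k).+1.

Definition equidistant x := forall k k', k \in K -> k' \in K -> d x k = d x k'.

Lemma clique_dist_le x k k' : k \in K -> k' \in K -> d x k' <= (d x k).+1.
Proof.
move=> kK kK'; have [->//|nk] := eqVneq k k'.
by apply: gm_triangle_adj; case: clK => + _; apply.
Qed.

(** A point of [K] farther away than [k1] would be adjacent to [k1] and [k2], so its geodesic to [x]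
    would have two first steps. *)
Lemma two_nearest_equidistant x k1 k2 : k1 \in K -> k2 \in K -> k1 != k2 ->
  d x k1 = d x k2 -> (forall k, k \in K -> d x k1 <= d x k) -> equidistant x.
Proof.
move=> k1K k2K n12 E minx.
suff H k : k \in K -> d x k = d x k1 by move=> k k' /H-> /H->.
move=> kK; apply/eqP; rewrite eqn_leq minx // andbT leqNgt; apply/negP => lt.
have Ek : d x k = (d x k1).+1.
  by apply/eqP; rewrite eqn_leq lt clique_dist_le.
have [ek1 ek2] : e k k1 /\ e k k2.
  split; case: clK => + _; apply=> //; apply/eqP => Ekk; rewrite Ekk in lt; lia.
apply/negP: n12; apply/negPn/eqP.
by apply: (@gm_uniq _ _ _ gm k x) => //; rewrite ![d _ x]gm_sym // Ek ?E.
Qed.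

Lemma nearest_or_equidistant x : K != set0 ->
  equidistant x \/ exists2 k, k \in K & nearest x k.
Proof.
case/set0Pn => k0 k0K.
have [k kK mink] : exists2 k, k \in K & forall k', k' \in K -> d x k <= d x k'.
  by case: (arg_minnP (d x) k0K) => k kK mink; exists k.
have [/existsP[k' /and3P[k'K nk /eqP E]]|/existsPn no] :=
  boolP [exists k', [&& k' \in K, k' != k & d x k' == d x k]].
  by left; apply: (@two_nearest_equidistant x k k'); rewrite // eq_sym.
right; exists k => // k' k'K nk; apply/eqP; rewrite eqn_leq clique_dist_le //.
by have := no k'; rewrite k'K nk /=; have := mink _ k'K; lia.
Qed.

(** Both ends of the edge are equally far from their nearest points. A step from [x'] towards [k']
    also approaches [k], as [x] does, so it is [x]; but [x] is farther from [k']. *)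
Lemma nearest_crossing x x' k k' : k \in K -> k' \in K -> k != k' ->
  nearest x k -> nearest x' k' -> e x x' -> x' = k'.
Proof.
move=> kK kK' nk nx nx' exx'.
have E1 := nx _ kK' ltac:(by rewrite eq_sym); have E2 := nx' _ kK nk.
have ex'x : e x' x by rewrite e_sym.
have S1 := gm_step gm k' exx'; have S2 := gm_step gm k ex'x.
have Er : d x k = d x' k' by lia.
apply/eqP; apply: contraT => n.
have [y ex'y Ey] := gm_next gm n.
have Sy : d x' k <= (d y k).+1 := gm_step gm k ex'y.
have Sy2 := @clique_dist_le y _ _ kK' kK.
have yx : y = x by apply: (@gm_uniq _ _ _ gm x' k) => //; lia.
rewrite yx in Ey; lia.
Qed.

Lemma nearest_unique x k k' : k \in K -> k' \in K -> nearest x k -> nearest x k' -> k = k'.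
Proof.
move=> kK k'K nx nx'; apply/eqP; apply: contraT => n.
by have := nx _ k'K; have := nx' _ kK n; rewrite eq_sym => -> /(_ n); lia.
Qed.

(** Every vertex has a nearest point in [K], and by [nearest_crossing] a geodesic can leave the
    region nearest to [v] only at [v]. *)
Lemma dist_through_gate v o x k : v \in K -> k \in K -> k != v ->
  (forall y, ~ equidistant y) -> nearest o k -> nearest x v ->
  d x v + d v o <= d x o.
Proof.
move=> vK kK nkv noeq no; have K0 : K != set0 by apply/set0Pn; exists v.
move: {2}(d x o) (leqnn (d x o)) => n; elim: n x => [|n IH] x.
  rewrite leqn0 (gm_eq0 gm) => /eqP -> nv.
  by rewrite (nearest_unique kK vK no nv) eqxx in nkv.
move=> le nx; have nxo : x != o.
  by apply/eqP => E; rewrite E in nx; rewrite (nearest_unique kK vK no nx) eqxx in nkv.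
have [x' exx' E] := gm_next gm nxo.
have [/noeq//|[k' k'K nx']] := nearest_or_equidistant x' K0.
have [Ek|nk'] := eqVneq k' v.
  rewrite Ek in nx'; have := IH x' ltac:(lia) nx'; have := gm_step gm v exx'; lia.
rewrite e_sym in exx'.
by rewrite (nearest_crossing k'K vK nk' nx' nx exx') gm_diag.
Qed.

(** Otherwise the geodesic from [u] to [o] passes through [v], and [u] is farther from [o] than [v]
    is. *)
Lemma equidistant_exists v o u k1 : v \in K -> k1 \in K -> k1 != v ->
  (forall x, d x o <= d v o) -> e v u -> u \notin K -> exists x, equidistant x.
Proof.
move=> vK k1K nk1 maxo evu uK.
have K0 : K != set0 by apply/set0Pn; exists v.
have noP : (exists x, equidistant x) \/ (forall x, ~ equidistant x).
  pose b x := [forall k in K, forall k' in K, d x k == d x k'].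
  have bP x : reflect (equidistant x) (b x).
    apply: (iffP forall_inP) => [H k k' kK k'K|H k kK].
      by have /forall_inP/(_ _ k'K)/eqP := H _ kK.
    by apply/forall_inP => k' k'K; apply/eqP; apply: H.
  have [/existsP[x /bP]|/existsPn no] := boolP [exists x, b x]; first by left; exists x.
  by right=> x /bP; apply/negP.
case: noP => // no; exfalso.
have [/no//|[k kK nok]] := nearest_or_equidistant o K0.
have nkv : k != v.
  apply/eqP => E; rewrite E in nok; have := nok _ k1K nk1; have := maxo k1.
  by rewrite ![d _ o]gm_sym; lia.
have evk : e v k by case: clK => + _; apply; rewrite // eq_sym.
have Eo : d v o = (d k o).+1.
  by rewrite ![d _ o]gm_sym; apply: nok; rewrite // eq_sym.
have nuo : nearest u v.
  have [/no//|[k' k'K nk']] := nearest_or_equidistant u K0.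
  have [<-//|nk'v] := eqVneq k' v.
  have := nk' _ vK ltac:(by rewrite eq_sym).
  rewrite [d u v]gm_sym (gm_adjE evu) => -[/esym/eqP]; rewrite (gm_eq0 gm) => /eqP E.
  by rewrite E k'K in uK.
have Du := dist_through_gate vK kK nkv no nok nuo.
have := maxo u; rewrite [d u v]gm_sym (gm_adjE evu) in Du; lia.
Qed.

(* The branching vertex is one closest to [K] among the vertices equidistant
   from [K]; two equal or adjacent first steps would yield a closer one or a
   second geodesic. *)
Lemma equidistant_branching k1 k2 : k1 \in K -> k2 \in K -> k1 != k2 ->
  (exists x, equidistant x) ->
  exists v (w : T -> T), (forall k, k \in K -> e v (w k)) /\
    {in K &, forall k k', k != k' -> w k != w k' /\ ~~ e (w k) (w k')}.
Proof.
move=> k1K k2K n12 [x0 eqx0].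
pose b x := [forall k in K, forall k' in K, d x k == d x k'].
have bP x : reflect (equidistant x) (b x).
  apply: (iffP forall_inP) => [H k k' kK k'K|H k kK].
    by have /forall_inP/(_ _ k'K)/eqP := H _ kK.
  by apply/forall_inP => k' k'K; apply/eqP; apply: H.
have /bP bx0 := eqx0.
case: (arg_minnP (fun x => d x k1) bx0) => v /bP eqv minv.
have dv k : k \in K -> d v k = d v k1 by move=> kK; apply: eqv.
have notvK : v \notin K.
  apply/negP => vK; have := dv _ vK; have := dv _ k2K; rewrite gm_diag => E1 E2.
  move: (E1); rewrite -E2 => /eqP; rewrite (gm_eq0 gm) => /eqP vk2.
  by move: E2 => /esym/eqP; rewrite (gm_eq0 gm) vk2 eq_sym (negbTE n12).
(* The first vertex on the geodesic from [v] to [k]; the default is not reached for [k] in [K],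
   since [v] is outside [K]. *)
pose w k := odflt v [pick y | e v y && (d v k == (d y k).+1)].
have wP k : k \in K -> e v (w k) /\ d v k = (d (w k) k).+1.
  move=> kK; rewrite /w; case: pickP => [y /andP[? /eqP]//|no].
  have nvk : v != k by apply: contraNneq notvK => ->.
  have [y evy E] := gm_next gm nvk.
  by have := no y; rewrite evy E eqxx.
(* A tie between [k] and [k'] would make [x] an equidistant vertex closer to [K] than [v]. *)
have small x : (forall k, k \in K -> d v k1 <= (d x k).+1) ->
    forall k k', k \in K -> k' \in K -> k != k' -> d v k1 = (d x k).+1 ->
    d x k' = (d x k).+1.
  move=> ge k k' kK k'K nk E; apply/eqP; rewrite eqn_leq clique_dist_le //.
  have := ge _ k'K; rewrite E ltnS leq_eqVlt => /orP[/eqP Exk|//].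
  have : equidistant x.
    by apply: (two_nearest_equidistant kK k'K nk Exk) => l /ge; rewrite E.
  move=> eqx; have /bP/minv := eqx; rewrite E (eqx k k1) //; lia.
have gev x : e v x -> forall k, k \in K -> d v k1 <= (d x k).+1.
  by move=> evx k kK; rewrite -(dv _ kK); apply: (gm_step gm).
exists v, w; split=> [k /wP[]//|k k' kK k'K nk].
have [evw Ew] := wP _ kK; have [evw' Ew'] := wP _ k'K.
have dwk' := small _ (gev _ evw) _ _ kK k'K nk (etrans (esym (dv _ kK)) Ew).
have dw'k := small _ (gev _ evw') _ _ k'K kK ltac:(by rewrite eq_sym)
  (etrans (esym (dv _ k'K)) Ew').
split; first by apply/eqP => E; rewrite -E in Ew'; move: Ew Ew' (dv _ kK) (dv _ k'K); lia.
apply/negP => eww'; rewrite e_sym in eww'.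
have Ekk : d v k = d v k' by rewrite (dv _ kK) (dv _ k'K).
(* Otherwise [w k = k] too, and [v] would have two neighbors in [K]. *)
have nw' : w k' != k'.
  rewrite -(gm_eq0 gm); apply/negP => /eqP E0.
  have /eqP : d (w k) k = 0 by lia.
  rewrite (gm_eq0 gm) => /eqP wkE; move: E0 => /eqP; rewrite (gm_eq0 gm) => /eqP wkE'.
  move: notvK; case: clK => _ /(_ v k k' kK k'K nk).
  by rewrite -{1}wkE -{1}wkE' => -> //.
(* The step from [w k'] towards [k'] also approaches [k], as [w k] does; but [w k] does not approach
   [k']. *)
have [y ewy Ey] := gm_next gm nw'.
have yw : y = w k.
  apply: (@gm_uniq _ _ _ gm (w k') k) => //; last by lia.
  have := gm_step gm k ewy; have := @clique_dist_le y _ _ k'K kK; lia.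
by rewrite yw in Ey; lia.
Qed.

End Clique.

(** * Components of a neighborhood *)

Definition local_clique v x : {set T} := [set y in neighborhood e v | (x == y) || e x y].

(** By [gm_adj_trans] a single step reaches the whole component. *)
Lemma connect_neighborhood v x y : x \in neighborhood e v ->
  connect (induced e (neighborhood e v)) x y = (y \in local_clique v x).
Proof.
move=> xN; apply/idP/idP => [/connectP[p]|]; last first.
  rewrite inE => /andP[yN /predU1P[<-//|exy]].
  by apply: connect1; rewrite /induced /= xN yN.
elim: p x xN => [|x' p IH] x xN /= => [_ ->|]; first by rewrite inE xN eqxx.
case/andP => /and3P[_ x'N exx'] pP lP.
have := IH _ x'N pP lP; move: xN x'N; rewrite !inE => evx evx' /andP[evy].
rewrite evy /= => /predU1P[<-|ex'y]; first by rewrite exx' orbT.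
by have [//|] := eqVneq x y; apply: (gm_adj_trans evx evx' evy exx' ex'y).
Qed.

Lemma connect_neighborhood_sym v : connect_sym (induced e (neighborhood e v)).
Proof.
by apply: sym_connect_sym => x y; rewrite /induced /= e_sym andbCA.
Qed.

Lemma independent_le_cliques v K (w : T -> T) :
  (forall k, k \in K -> e v (w k)) ->
  {in K &, forall k k', k != k' -> w k != w k' /\ ~~ e (w k) (w k')} ->
  #|K| <= num_cliques_at e v.
Proof.
move=> evw indep; set N := neighborhood e v; set r := fingraph.root (induced e N).
have csym := connect_neighborhood_sym v.
have wN k : k \in K -> w k \in N by move=> kK; rewrite inE evw.
have inj : {in K &, injective (r \o w)}.
  move=> k k' kK k'K /= /eqP; rewrite /r root_connect // connect_neighborhood ?wN //.
  rewrite !inE => /andP[_ sim]; apply/eqP; apply: contraTT sim => nk.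
  by have [/negbTE -> /negbTE ->] := indep _ _ kK k'K nk.
rewrite -(card_in_imset inj) /num_cliques_at /num_components /n_comp_mem.
apply: subset_leq_card; apply/subsetP => _ /imsetP[k kK ->].
rewrite inE /= roots_root //= -/N.
have := connect_root (induced e N) (w k).
by rewrite connect_neighborhood ?wN // inE => /andP[].
Qed.

Lemma num_cliques_le_cover v (A : {set T}) :
  (forall y, e v y -> exists2 x, e v x && (x \in A) & y \in local_clique v x) ->
  num_cliques_at e v <= #|A|.
Proof.
move=> cov; set N := neighborhood e v; set r := fingraph.root (induced e N).
have csym := connect_neighborhood_sym v.
apply: leq_trans (leq_imset_card r A); apply: subset_leq_card; apply/subsetP => y.
rewrite inE /= => /andP[/eqP ry]; rewrite inE => /cov[x /andP[evx xA] xy].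
apply/imsetP; exists x => //; rewrite -[LHS]ry; apply/esym/eqP.
by rewrite root_connect // connect_neighborhood // inE.
Qed.

(** A vertex other than [v] with two neighbors in this set is adjacent to [v], and then
    [gm_adj_trans] puts it into the component of [x]. *)
Lemma local_clique_closed v x : e v x -> closed_clique (v |: local_clique v x).
Proof.
move=> evx.
have lcP y : y \in local_clique v x -> e v y /\ (x = y \/ e x y).
  by rewrite !inE => /andP[-> /predU1P[|]]; auto.
have pw : {in v |: local_clique v x &, forall k k', k != k' -> e k k'}.
  move=> k k' /setU1P[->|/lcP[evk xk]] /setU1P[->|/lcP[evk' xk']] nk //.
  - by rewrite eqxx in nk.
  - by rewrite e_sym.
  case: xk => [kE|exk].
    by move: nk; case: xk' => [<-|]; rewrite -kE ?eqxx.
  case: xk' => [<-|exk']; first by rewrite e_sym.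
  by apply: (gm_adj_trans evk evx evk') => //; rewrite e_sym.
split=> // u k k' kK k'K nk euk euk'.
have ekk' := pw _ _ kK k'K nk.
rewrite in_setU1; have [//|nuv] := eqVneq u v.
wlog kv : k k' kK k'K nk euk euk' ekk' / k != v => [H|].
  have [kv|] := eqVneq k v; last exact: (H k k').
  by apply: (H k' k) => //; rewrite 1?e_sym // eq_sym -?kv.
have [evk xk] : e v k /\ (x = k \/ e x k).
  by case/setU1P: kK => [E|/lcP//]; rewrite E eqxx in kv.
have evu : e v u.
  case/setU1P: k'K => [<-|/lcP[evk' _]]; first by rewrite e_sym.
  by apply: (@gm_adj_trans k v k' u);
    rewrite ?[e k v]e_sym ?[e k u]e_sym ?[e k' u]e_sym // eq_sym.
rewrite !inE evu /=; have [//|nxu] := eqVneq x u.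
case: xk => [->|exk]; first by rewrite e_sym.
by apply: (gm_adj_trans evx evk evu) => //; rewrite e_sym.
Qed.

(* Summing [(c - 1) * (c - (M - 1)) <= 0] over the sizes [c] of the cliques. *)
Lemma sum_local_clique_bound v (M := num_cliques_at e v) : 0 < M ->
  (forall x, e v x -> #|local_clique v x| < M) ->
  \sum_(x in neighborhood e v) #|local_clique v x| + M * M.-1
    <= M * #|neighborhood e v|.
Proof.
move=> M0 bound; set N := neighborhood e v; set E := induced e N.
have csym := connect_neighborhood_sym v.
have rN x : x \in N -> fingraph.root E x \in N.
  move=> xN; have := connect_root E x; rewrite -/N.
  by rewrite connect_neighborhood // inE => /andP[].
have partN (F : T -> nat) : \sum_(x in N) F x =
    \sum_(r in predI (roots E) (mem N)) \sum_(x in local_clique v r) F x.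
  rewrite (partition_big (fingraph.root E) (mem (predI (roots E) (mem N)))) /=; last first.
    by move=> x xN; rewrite !inE roots_root //=; have := rN x xN; rewrite inE.
  apply: eq_bigr => r; rewrite inE /= => /andP[/eqP rr rinN]; apply: eq_bigl => x.
  have [xN|xN] /= := boolP (x \in N); last by rewrite inE (negbTE xN).
  by rewrite -{1}rr root_connect // csym connect_neighborhood.
have sizeE r x : r \in N -> x \in local_clique v r ->
    #|local_clique v x| = #|local_clique v r|.
  move=> rinN xr; apply: eq_card => y.
  have xN : x \in N by move: xr; rewrite inE => /andP[].
  rewrite -!connect_neighborhood //; apply: (same_connect csym).
  by rewrite csym connect_neighborhood.
have MN : M * M.-1 = \sum_(r in predI (roots E) (mem N)) M.-1 by rewrite sum_nat_const.
have NE : #|N| = \sum_(r in predI (roots E) (mem N)) #|local_clique v r|.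
  by rewrite -sum1_card partN; apply: eq_bigr => r _; rewrite sum1_card.
rewrite MN NE partN -big_split big_distrr /=; apply: leq_sum => r.
rewrite inE /= => /andP[_ rinN].
rewrite (eq_bigr (fun=> #|local_clique v r|)) => [|x /(sizeE _ _ rinN)//].
rewrite sum_nat_const.
have := bound r ltac:(by move: rinN; rewrite inE).
have : 0 < #|local_clique v r|.
  by apply/card_gt0P; exists r; rewrite inE rinN eqxx.
move: (#|local_clique v r|) M0; rewrite /M.
by move: (num_cliques_at e v) => [//|M'] c _ /=; nia.
Qed.

End Graph.

(** * Geodetic Cayley graphs *)

Section Cayley.

Local Open Scope group_scope.

Variables (gT : finGroupType) (S : {set gT}) (d : gT -> gT -> nat).
Hypotheses (S1 : 1 \notin S) (SV : S^-1 = S).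
Hypothesis gm : geodetic_metric (cayley S) d.
Implicit Types (a b c g h x y z : gT) (i j k n : nat).

Lemma cayleyE g h : cayley S g h = (g^-1 * h \in S).
Proof.
apply/existsP/idP => [[a /andP[aS /eqP ->]]|H]; first by rewrite mulKg.
by exists (g^-1 * h); rewrite H mulKVg eqxx.
Qed.

Lemma memSV a : (a^-1 \in S) = (a \in S).
Proof. by rewrite -{1}SV memV_invg. Qed.

Lemma cayley_sym : symmetric (cayley S).
Proof. by move=> g h; rewrite !cayleyE -memSV invMg invgK. Qed.

Lemma cayley_irr : irreflexive (cayley S).
Proof. by move=> g; rewrite cayleyE mulVg (negbTE S1). Qed.

Lemma cayley_mull x g h : cayley S (x * g) (x * h) = cayley S g h.
Proof. by rewrite !cayleyE invMg -mulgA mulKg. Qed.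

Lemma cayley_mulr g a : a \in S -> cayley S g (g * a).
Proof. by rewrite cayleyE mulKg. Qed.

Lemma cayley_nbhd1 x : (x \in neighborhood (cayley S) 1) = (x \in S).
Proof. by rewrite inE cayleyE invg1 mul1g. Qed.

Lemma dist_mull x g h : d (x * g) (x * h) = d g h.
Proof.
suff le u g' h' : d (u * g') (u * h') <= d g' h'.
  by apply/eqP; rewrite eqn_leq le; have := le x^-1 (x * g) (x * h); rewrite !mulKg.
move: {2}(d g' h') (leqnn (d g' h')) => n; elim: n g' => [|n IH] g'.
  by rewrite leqn0 (gm_eq0 gm) => /eqP ->; rewrite !(gm_diag gm).
have [->|ngh] := eqVneq g' h'; first by rewrite !(gm_diag gm).
have [g1 eg E] := gm_next gm ngh; rewrite E ltnS => le.
rewrite -(cayley_mull u) in eg.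
by apply: leq_trans (gm_step gm _ eg) _; rewrite ltnS; apply: IH.
Qed.

(** * Word length and last letters *)

Definition len g := d 1 g.

Lemma len_eq0 g : (len g == 0) = (g == 1).
Proof. by rewrite /len (gm_eq0 gm) eq_sym. Qed.

Lemma len1 : len 1 = 0.
Proof. by apply/eqP; rewrite len_eq0. Qed.

Lemma distE g h : d g h = len (g^-1 * h).
Proof. by rewrite /len -(dist_mull g^-1) mulVg. Qed.

Lemma lenV g : len g^-1 = len g.
Proof. by rewrite {2}/len (gm_sym gm cayley_sym cayley_irr) distE mulg1. Qed.

Lemma distr1 g : d g 1 = len g.
Proof. by rewrite distE mulg1 lenV. Qed.

Lemma len_gen a : a \in S -> len a = 1%N.
Proof.
by move=> aS; apply: (gm_adjE gm cayley_irr); rewrite cayleyE invg1 mul1g.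
Qed.

Lemma lenS a : len a = 1%N -> a \in S.
Proof. by move/(gm_adj gm); rewrite cayleyE invg1 mul1g. Qed.

Lemma len_mulr a g : a \in S -> len (g * a) <= (len g).+1.
Proof.
by move=> aS; apply: (gm_triangle_adj gm cayley_irr); apply: cayley_mulr.
Qed.

Lemma len_mulr_ge a g : a \in S -> len g <= (len (g * a)).+1.
Proof.
by move=> aS; rewrite -{1}(mulgK a g); apply: len_mulr; rewrite memSV.
Qed.

Lemma len_mull a g : a \in S -> len (a * g) <= (len g).+1.
Proof. by move=> aS; rewrite -lenV invMg -(lenV g) len_mulr ?memSV. Qed.

(** [a] is the last letter of the geodesic word of [g]; equivalently, [g * a^-1] is the first step
    from [g] to [1]. *)
Definition ends g a := [/\ a \in S & len g = (len (g * a^-1)).+1].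

Lemma ends_exists g : g != 1 -> exists a, ends g a.
Proof.
move=> ng1; have [h e1h E] := @gm_next _ _ _ gm g 1 ng1.
exists (h^-1 * g); split; first by rewrite -cayleyE cayley_sym.
by rewrite invMg invgK mulKVg -!distr1.
Qed.

Lemma ends_uniq g a b : ends g a -> ends g b -> a = b.
Proof.
move=> [aS Ea] [bS Eb]; apply: invg_inj; apply: (mulgI g).
apply: (@gm_uniq _ _ _ gm g 1); rewrite ?distr1 // cayley_mulr ?memSV //.
Qed.

Lemma ends_mulr g a : a \in S -> len (g * a) = (len g).+1 -> ends (g * a) a.
Proof. by move=> aS E; split; rewrite ?mulgK. Qed.

(* [g a = a g] would otherwise have two geodesics, one ending in [a] and one
   ending in the last letter of [g]. *)
Lemma commute_len_up g c : c \in S -> commute g c -> len (g * c) = (len g).+1 ->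
  g = c ^+ len g.
Proof.
move=> cS; move: {2}(len g) (leqnn (len g)) => n; elim: n g => [|n IH] g.
  by rewrite leqn0 len_eq0 => /eqP ->; rewrite len1.
have [-> _ _ _|ng1] := eqVneq g 1; first by rewrite len1.
move=> le cgc E; have [b gb] := ends_exists ng1; have [bS Eb] := gb.
have bc : b = c.
  apply: (@ends_uniq (g * c)); last exact: ends_mulr.
  split=> //; apply/eqP; rewrite eqn_leq; apply/andP; split.
    by rewrite -{1}(mulgKV b (g * c)) len_mulr.
  by rewrite E ltnS cgc -mulgA Eb len_mull.
rewrite bc in Eb; rewrite {1}Eb expgSr -IH ?mulgKV //; first by rewrite -ltnS -Eb.
by apply/commute_sym/commuteM; [apply/commute_sym | apply: commuteV].
Qed.

Lemma commute_len_down g c : c \in S -> commute g c -> len g = (len (g * c)).+1 ->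
  g = c ^- len g.
Proof.
move=> cS cgc E.
have := @commute_len_up (g * c) c^-1; rewrite memSV mulgK => /(_ cS) H.
rewrite {1}E expgS invMg -expgVn -H ?mulgK //.
by apply/commuteV/commute_sym/commuteM => //; apply: commute_sym.
Qed.

Lemma len_expg a k : a \in S -> len (a ^+ k) <= k.
Proof.
move=> aS; elim: k => [|k IH]; first by rewrite len1.
by rewrite expgSr; apply: leq_trans (len_mulr _ aS) _.
Qed.

Lemma len_expg_prefix a i k : a \in S -> len (a ^+ k) = k -> i <= k ->
  len (a ^+ i) = i.
Proof.
move=> aS E ik; apply/eqP; rewrite eqn_leq len_expg //=.
elim: k ik E => [|k IH]; first by rewrite leqn0 => /eqP ->.
rewrite leq_eqVlt => /predU1P[-> ->//|ik E]; apply: IH => //.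
by have := len_mulr (a ^+ k) aS; have := len_expg k aS; rewrite -expgSr E; lia.
Qed.

Lemma ends_expg a k : a \in S -> len (a ^+ k.+1) = k.+1 -> ends (a ^+ k.+1) a.
Proof.
move=> aS E; split=> //.
by rewrite E expgSr mulgK (len_expg_prefix aS E).
Qed.

(** Since [t] is its own inverse, its geodesic word starts with the inverse of its last letter;
    removing both leaves a conjugate involution, shorter by 2. *)
Lemma involution_odd_len t : t * t = 1 -> t != 1 -> odd (len t).
Proof.
move: {2}(len t) (leqnn (len t)) => n; elim: n t => [|n IH] t.
  by rewrite leqn0 len_eq0 => /eqP ->; rewrite eqxx.
move=> le tt nt1; have tV : t^-1 = t by rewrite -[RHS](mulKg t) tt mulg1.
have [b [bS E]] := ends_exists nt1.
have [/eqP|ntb1] := eqVneq (t * b^-1) 1.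
  by rewrite -len_eq0 E => /eqP ->.
have bt : b * t = (t * b^-1)^-1 by rewrite invMg invgK tV.
have [f [fS Ef]] := @ends_exists (b * t) ltac:(by rewrite bt invg_eq1).
have lbt : len (b * t) = len (t * b^-1) by rewrite bt lenV.
have fb : f = b.
  apply: (@ends_uniq t) => //; split=> //; apply/eqP; rewrite eqn_leq.
  have := len_mulr (t * f^-1) fS; rewrite mulgKV => -> /=.
  have := len_mull (b * t * f^-1) (etrans (memSV b) bS).
  rewrite -[b * t * f^-1]mulgA mulKg mulgA => H.
  by rewrite E ltnS -lbt Ef.
rewrite fb in Ef; have lt1 : len t = (len (b * t * b^-1)).+2 by rewrite E -lbt Ef.
rewrite lt1 /= negbK; apply: IH; first by lia.
  by rewrite -!mulgA mulKg [t * (t * _)]mulgA tt mul1g mulgV.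
rewrite -eq_mulgV1; apply: contraNneq nt1 => bt1.
by apply/eqP/(mulgI b); rewrite bt1 mulg1.
Qed.

Section Powers.

Variable c : gT.
Hypothesis cS : c \in S.

(* The length function along the powers of [c] rises to [M], stays constant,
   and finally descends along the powers of [c^-1]. *)
Lemma len_expg_profile : exists M, forall n, let l := len (c ^+ n) in
  l <= M /\ [\/ l = M, c ^+ n = c ^+ l | c ^+ n = c ^- l].
Proof.
(* [M] will be the largest exponent up to which all powers of [c] are geodesic; the order of [c]
   bounds it. *)
have exM : exists M, len (c ^+ M.+1) != M.+1.
  exists #[c].-1; rewrite prednK ?order_gt0 // expg_order len1.
  by rewrite eq_sym -lt0n order_gt0.
case: (ex_minnP exM) => M /eqP top minM.
have low i : i <= M -> len (c ^+ i) = i.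
  case: i => [|i iM]; first by rewrite len1.
  by apply/eqP; apply: contraT => /minM; rewrite leqNgt iM.
exists M; elim=> [|n]; first by rewrite len1; split=> //; apply: Or32.
rewrite /=; set l := len (c ^+ n) => -[lM].
have cn : commute (c ^+ n) c by apply/commute_sym/commuteX.
have up : len (c ^+ n.+1) <= l.+1 by rewrite expgSr len_mulr.
have dn : l <= (len (c ^+ n.+1)).+1 by rewrite expgSr len_mulr_ge.
have pos : l < M -> c ^+ n = c ^+ l -> len (c ^+ n.+1) <= M /\
    [\/ len (c ^+ n.+1) = M, c ^+ n.+1 = c ^+ len (c ^+ n.+1)
      | c ^+ n.+1 = c ^- len (c ^+ n.+1)].
  move=> ltM E; have E1 : c ^+ n.+1 = c ^+ l.+1 by rewrite !expgSr E.
  by rewrite E1 low //; split=> //; apply: Or32.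
have neg : 0 < l -> c ^+ n = c ^- l -> len (c ^+ n.+1) <= M /\
    [\/ len (c ^+ n.+1) = M, c ^+ n.+1 = c ^+ len (c ^+ n.+1)
      | c ^+ n.+1 = c ^- len (c ^+ n.+1)].
  move=> l0 E; have E1 : c ^+ n.+1 = c ^- l.-1.
    by rewrite expgSr E -[in LHS](prednK l0) expgS invMg mulgKV.
  have ll : len (c ^+ n.+1) = l.-1 by rewrite E1 lenV low //; lia.
  by rewrite ll E1; split; [lia | apply: Or33].
(* On the plateau, a rise would give [c ^+ n = c ^+ M] and contradict the choice of [M], while a
   drop forces [c ^+ n = c ^- M]. *)
have [lE|lneM] := eqVneq l M.
  move=> _; have [E|] := eqVneq (len (c ^+ n.+1)) l.+1.
    have En : c ^+ n = c ^+ M.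
      by rewrite -lE; apply: commute_len_up; rewrite // -expgSr.
    by case: top; rewrite expgSr -En -expgSr E lE.
  have [E|] := eqVneq l (len (c ^+ n.+1)).+1.
    move=> _; apply: neg; first by rewrite E.
    by apply: commute_len_down; rewrite // -expgSr.
  move=> n1 n2; have E : len (c ^+ n.+1) = M.
    by rewrite -lE; apply/eqP; rewrite eqn_leq; lia.
  split; first by rewrite E.
  exact: Or31.
have ltM : l < M by lia.
case=> [E|E|E]; [by rewrite E eqxx in lneM | exact: pos |].
have [l0|] := posnP l; last by move=> l0; apply: neg.
by apply: pos => //; rewrite E l0 invg1.
Qed.

End Powers.

(** The power is its own inverse, so its geodesic word ends both in [a] and in [a^-1]. *)
Lemma expg_involution a k : a \in S -> len (a ^+ k.+1) = k.+1 ->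
  a ^+ k.+1 * a ^+ k.+1 = 1 -> a * a = 1.
Proof.
move=> aS E inv; have aV : a ^+ k.+1 = a^-1 ^+ k.+1.
  by apply: (mulgI (a ^+ k.+1)); rewrite inv expgVn mulgV.
suff aE : a = a^-1 by rewrite {1}aE mulVg.
apply: (@ends_uniq (a ^+ k.+1)); first exact: ends_expg.
by rewrite aV; apply: ends_expg; rewrite ?memSV // -aV.
Qed.

(** * Lengths of central elements *)

Lemma central_commute z g : z \in 'Z([set: gT]) -> commute z g.
Proof. by case/centerP => _; apply; rewrite inE. Qed.

(** Removing the last letter [c] of [z] leaves an element commuting with [c], which [commute_len_up]
    makes a power of [c]. *)
Lemma central_expg z : z \in 'Z([set: gT]) -> z != 1 ->
  exists c, [/\ c \in S, z = c ^+ len z & 0 < len z].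
Proof.
move=> zZ nz1; have [c [cS E]] := ends_exists nz1; exists c; split=> //; last by rewrite E.
rewrite -{1}(mulgKV c z) {1}E expgSr; congr (_ * _).
apply: commute_len_up; rewrite ?mulgKV //.
apply/commute_sym/commuteM; last exact: commuteV.
by apply/commute_sym/central_commute.
Qed.

(** If [b] lengthened [z], then [z] would be a power of [b] and end in [b]; if it shortened [z],
    then [z] would end in [b^-1]. Both contradict the last letter [c]. *)
Lemma central_len_mul z c b : z \in 'Z([set: gT]) -> z != 1 -> c \in S ->
  z = c ^+ len z -> b \in S -> b != c -> b != c^-1 -> len (z * b) = len z.
Proof.
move=> zZ nz1 cS zc bS nbc nbcV; have zb := central_commute b zZ.
have zE a : a \in S -> z = a ^+ len z -> ends z a.
  move: nz1; rewrite -len_eq0; case E: (len z) => [//|k] _ aS za.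
  by rewrite za; apply: ends_expg => //; rewrite -za.
have [E|nup] := eqVneq (len (z * b)) (len z).+1.
  have := commute_len_up bS zb E => /(zE _ bS) zb'.
  by rewrite (ends_uniq zb' (zE _ cS zc)) eqxx in nbc.
have [E|ndown] := eqVneq (len z) (len (z * b)).+1.
  have /(ends_uniq (zE _ cS zc)) cb : ends z b^-1 by split; rewrite ?memSV ?invgK.
  by rewrite cb invgK eqxx in nbcV.
apply/eqP; rewrite eqn_leq; have := len_mulr z bS; have := len_mulr_ge z bS; lia.
Qed.

Section NoCentralGenerator.

Hypothesis noZ : forall a, a \in S -> a \notin 'Z([set: gT]).

(** Otherwise [z] is a geodesic power of some [c] with [c * c = 1], so it has length 1 and is a
    central generator. *)
Lemma central_involution z : z \in 'Z([set: gT]) -> z * z = 1 -> z = 1.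
Proof.
move=> zZ zz; apply/eqP; apply: contraT => nz1.
have [c [cS zc lz]] := central_expg zZ nz1.
have cc : c * c = 1.
  by apply: (@expg_involution c (len z).-1); rewrite ?prednK // -zc.
have : len z <= 1.
  rewrite leqNgt; apply/negP => lz2.
  have := @len_expg_prefix c 2 (len z) cS (esym (congr1 len zc)) lz2.
  by rewrite expgS expg1 cc len1.
rewrite leq_eqVlt ltnNge lz orbF => /eqP l1.
by rewrite l1 expg1 in zc; rewrite zc (negbTE (noZ cS)) in zZ.
Qed.

Lemma odd_order_central z : z \in 'Z([set: gT]) -> odd #[z].
Proof.
move=> zZ; apply: contraT => ev.
have oE : #[z] = (#[z]./2 + #[z]./2)%N by rewrite addnn even_halfK.
have := @central_involution (z ^+ #[z]./2) ltac:(by rewrite groupX).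
rewrite -expgD -oE expg_order => /(_ erefl) /eqP; rewrite -order_dvdn => /dvdn_leq.
have := order_gt0 z; move: oE; move: #[z] => o; lia.
Qed.

(* If [z = a^2] is central of length 2, then it has odd order, so it has a
   central square root [y], and [t = a y^-1] is an involution, hence of odd
   length. The length profile of the powers of the generator underlying [y]
   shows that [y] is a power of [a] or of [a^-1], which is incompatible with
   that parity. *)
Lemma central_len_neq2 z : z \in 'Z([set: gT]) -> len z != 2.
Proof.
move=> zZ; apply/negP => /eqP lz2.
have nz1 : z != 1 by rewrite -len_eq0 lz2.
have [a [aS za _]] := central_expg zZ nz1; rewrite lz2 in za.
have naa : a * a != 1 by rewrite -expg2 -za.
(* As [z] has odd order, this power is a square root of [z]. *)
pose y := z ^+ (#[z].+1./2); have yZ : y \in 'Z([set: gT]) by rewrite groupX.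
have yy : y * y = z.
  rewrite -expgD addnn even_halfK; last by rewrite /= negbK odd_order_central.
  by rewrite expgS expg_order mulg1.
have ny1 : y != 1 by apply: contraNneq nz1 => y1; rewrite -yy y1 mulg1.
have yC g := central_commute g yZ.
have [c [cS yc ly]] := central_expg yZ ny1; set j := len y in yc ly.
have j1 : j != 1%N.
  by apply: contraTneq yZ => j1; rewrite yc j1 expg1 noZ.
pose t := a * y^-1.
have tt : t * t = 1.
  rewrite /t mulgA -[a * y^-1 * a]mulgA -(commuteV (commute_sym (yC a))) mulgA.
  by rewrite -expg2 -za -yy mulgK mulgV.
have nt1 : t != 1.
  by rewrite /t -eq_mulgV1; apply: contraTneq yZ => <-; apply: noZ.
have odt := involution_odd_len tt nt1.
(* Otherwise the profile at [j + j] leaves only the plateau [M = 2]; then [j = 2], and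
   [central_len_mul] gives [t] even length. *)
have ac : a = c \/ a = c^-1.
  have [|nac] := eqVneq a c; first by left.
  have [|nacV] := eqVneq a c^-1; [by right|exfalso].
  have ea : ends z a by rewrite za; apply: ends_expg; rewrite -?za.
  have zc : z = c ^+ (j + j) by rewrite expgD -yc.
  have [M prof] := len_expg_profile cS.
  have [jM _] := prof j; rewrite -yc -/j in jM.
  have [_] := prof (j + j)%N; rewrite -zc lz2 => -[M2|E|E].
  - have j2 : j = 2 by lia.
    have yV1 : y^-1 != 1 by rewrite invg_eq1.
    have := @central_len_mul y^-1 c^-1 a; rewrite groupV memSV invgK lenV expgVn -/j -yc.
    move=> /(_ yZ yV1 cS erefl aS nacV nac).
    by rewrite -(commuteV (commute_sym (yC a))) => Et; rewrite Et j2 in odt.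
  - have ec : ends z c by rewrite E; apply: ends_expg; rewrite -?E.
    by rewrite (ends_uniq ea ec) eqxx in nac.
  - rewrite -expgVn in E.
    have ec : ends z c^-1 by rewrite E; apply: ends_expg; rewrite ?memSV -?E.
    by rewrite (ends_uniq ea ec) eqxx in nacV.
case: ac => E.
  (* Here [t^-1] is a geodesic power of [a] and an involution, which forces [a * a = 1]. *)
  rewrite -E in yc; have tE : t^-1 = a ^+ j.-1.
    by rewrite /t invMg invgK yc -{1}(prednK ly) expgSr mulgK.
  have jj : j.-1 = j.-2.+1 by lia.
  move/eqP: naa; apply; apply: (@expg_involution a j.-2); rewrite // -jj.
    by apply: (len_expg_prefix aS _ (leq_pred j)); rewrite -yc.
  by rewrite -tE -invMg tt invg1.
have {}yc : y = a ^- j by rewrite E expgVn invgK.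
have aj : len (a ^+ j) = j by rewrite -lenV -yc.
have tE : t = a ^+ j.+1 by rewrite /t yc invgK expgS.
have ajZ : a ^+ j \in 'Z([set: gT]) by rewrite -groupV -yc.
(* For odd [j], [a] is [a ^+ j] times a power of [z], hence central. *)
have evj : ~~ odd j.
  apply/negP => oj; have /negP := noZ aS; apply.
  suff aE : a = a ^+ j * (z ^+ j./2)^-1 by rewrite {1}aE groupM // groupV groupX.
  have jE : j = (j./2.*2).+1 by rewrite -{1}(odd_double_half j) oj.
  by rewrite za -expgM {1}jE mul2n expgS mulgK.
have up := len_mulr (a ^+ j) aS; have dn := len_mulr_ge (a ^+ j) aS.
rewrite -expgSr -tE aj in up dn.
(* By parity [t] has length [j.+1] or [j.-1]. The former gives [a * a = 1], the latter makes
   [a ^+ j] its own inverse, so [z = 1]. *)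
have [l|nl] := eqVneq (len t) j.+1.
  by move/eqP: naa; apply; apply: (@expg_involution a j); rewrite // -tE.
have ld : j = (len t).+1.
  have : len t != j by apply: contraTneq odt => ->.
  move=> nj; apply/eqP; rewrite eqn_leq dn; move: up.
  by rewrite leq_eqVlt (negbTE nl) ltnS leq_eqVlt (negbTE nj).
have := @commute_len_down (a ^+ j) a aS ltac:(by apply/commute_sym/commuteX).
rewrite -expgSr -tE aj => /(_ ld) E2.
move/eqP: nz1; apply.
by rewrite -yy {1}yc -E2 -[a ^+ j]invgK -yc mulVg.
Qed.

Lemma central_len_ge3 z : z \in 'Z([set: gT]) -> z != 1 -> 2 < len z.
Proof.
move=> zZ nz1; have := central_len_neq2 zZ.
have : len z != 0 by rewrite len_eq0.
have : len z != 1%N by apply: contraTneq zZ => /lenS; apply: noZ.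
by case: (len z) => [|[|[]]].
Qed.

End NoCentralGenerator.

Let kappa x := #|local_clique (cayley S) 1 x|.
Let m := num_cliques_at (cayley S) 1.

Lemma mem_local_clique b c : b \in S -> c \in S ->
  (c \in local_clique (cayley S) 1 b^-1) = (len (b * c) <= 1).
Proof.
move=> bS cS; rewrite inE cayley_nbhd1 cS cayleyE invgK /=.
apply/idP/idP => [/predU1P[<-|]|].
- by rewrite mulgV len1.
- by move/len_gen ->.
rewrite leq_eqVlt ltnS leqn0 len_eq0 => /orP[/eqP/lenS ->|].
  by rewrite orbT.
by rewrite -eq_invg_mul => ->.
Qed.

(** * Balls of radius 2 and their translates *)

Definition ball2 z := [set g | len (z^-1 * g) <= 2].

Lemma card_ball2 z : #|ball2 z| = #|ball2 1|.
Proof.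
rewrite -(card_imset (ball2 1) (mulgI z)); apply: eq_card => g.
apply/idP/imsetP => [|[h hB ->]]; last by rewrite inE mulKg; rewrite inE invg1 mul1g in hB.
by rewrite inE => gB; exists (z^-1 * g); rewrite ?mulKVg // inE invg1 mul1g.
Qed.

(** The sum of [kappa] adds the squares of the clique sizes and counts the pairs with product of
    length at most 1. A product of length 2 determines its pair, whose second entry is its last
    letter. *)
Lemma card_ball2_ge :
  (1 + #|S| + #|S| * #|S| <= #|ball2 1%g| + \sum_(x in S) kappa x)%N.
Proof.
pose P := [set p in setX S S | len (p.1 * p.2) == 2].
have cardP : (#|S| * #|S| = #|P| + \sum_(x in S) kappa x)%N.
  rewrite -cardsX -(cardsID [set p | len (p.1 * p.2) == 2] (setX S S)).
  congr (_ + _)%N; first by apply: eq_card => p; rewrite !inE.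
  rewrite -sum1_card.
  rewrite [RHS](reindex_inj invg_inj) /= (eq_bigl (mem S)) => [|x]; last by rewrite memSV.
  under [RHS]eq_bigr do rewrite /kappa -sum1_card.
  rewrite pair_big_dep /=; apply: eq_bigl => -[b c]; rewrite !in_setD in_setX inE /=.
  have [bS|] /= := boolP (b \in S); last by rewrite andbF.
  have [cS|cS] /= := boolP (c \in S); last by rewrite andbF inE cayley_nbhd1 (negbTE cS).
  rewrite andbT mem_local_clique //.
  have := len_mulr b cS; rewrite (len_gen bS); case: (len _) => [|[|[]]] //.
have injP : {in P &, injective (fun p : gT * gT => p.1 * p.2)}.
  move=> [b c] [b' c']; rewrite !inE /= => /andP[/andP[bS cS] /eqP l2].
  move=> /andP[/andP[bS' cS'] /eqP l2'] E.
  have cc' : c = c'.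
    apply: (ends_uniq (g := b * c)); split=> //.
      by rewrite mulgK l2 (len_gen bS).
    by rewrite l2 E mulgK (len_gen bS').
  by move: E; rewrite cc' => /mulIg ->.
rewrite cardP addnA leq_add2r -(card_in_imset injP).
set I := imset _ _.
have Il g : g \in I -> len g = 2 by case/imsetP => p; rewrite !inE => /andP[_ /eqP <-] ->.
have disj : [disjoint 1 |: S & I].
  rewrite disjoints_subset; apply/subsetP => g gS; rewrite inE; apply/negP => /Il.
  by case/setU1P: gS => [->|/len_gen ->]; rewrite ?len1.
have -> : (1 + #|S| + #|I| = #|(1%g |: S) :|: I|)%N.
  by rewrite cardsU (disjoint_setI0 disj) cards0 subn0 cardsU1 S1 //.
apply: subset_leq_card; apply/subsetP => g /setUP gin; rewrite inE invg1 mul1g.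
by case: gin => [/setU1P[->|/len_gen ->]|/Il ->] //; rewrite len1.
Qed.

(* Let [a] be the last letter of [z]. An element [b c] of the overlap either has
   [b = a^-1], or [c^-1] is the last letter of [z b], so [b] determines [c]. *)
Lemma ball2_overlap_lt z : z \in 'Z([set: gT]) -> 2 < len z ->
  #|[set g | len g <= 2] :&: [set g | len (z * g) <= 2]| < (2 * #|S|)%N.
Proof.
move=> zZ lz; have nz1 : z != 1 by rewrite -len_eq0 -lt0n; lia.
have [a [aS Ea]] := ends_exists nz1.
have aVS : a^-1 \in S by rewrite memSV.
(* The inverse of the last letter of [z * b]; the default [1] only makes [f] total. *)
pose f b := oapp invg 1 [pick c in S | len (z * b) == (len (z * b * c^-1)).+1].
have sub : [set g | len g <= 2] :&: [set g | len (z * g) <= 2] \subset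
    a^-1 |: ([set a^-1 * c | c in S :\ a] :|: [set b * f b | b in S :\ a^-1]).
  apply/subsetP => g; rewrite !inE => /andP[lg lzg].
  have down b : b \in S -> len (z * b) < len z -> b = a^-1.
    move=> bS lt; rewrite -[b]invgK; congr (_^-1).
    apply: (ends_uniq (g := z)) => //; split; rewrite ?memSV // invgK.
    by apply/eqP; rewrite eqn_leq lt len_mulr_ge.
  have [g1|ng1] := eqVneq g 1; first by move: lzg; rewrite g1 mulg1 leqNgt lz.
  have [c [cS Ec]] := ends_exists ng1.
  set b := g * c^-1 in Ec; have gE : g = b * c by rewrite mulgKV.
  have [b1|nb1] := eqVneq b 1.
    rewrite gE b1 mul1g in lzg *; have /down -> // : len (z * c) < len z by lia.
    by rewrite eqxx.
  have bS : b \in S.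
    apply: lenS; rewrite -len_eq0 in nb1; lia.
  apply/orP; right; have [ba|nba] := eqVneq b a^-1.
    apply/orP; left; apply/imsetP; exists c; rewrite -?ba //.
    by rewrite !inE cS andbT; apply: contraNneq ng1 => ca; rewrite gE ba ca mulVg.
  apply/orP; right; apply/imsetP; exists b; first by rewrite !inE nba bS.
  have zb3 : len z <= len (z * b).
    by rewrite leqNgt; apply: contra nba => /(down _ bS) ->.
  (* [z * b] has length at least 3 and [z * b * c] at most 2. *)
  have cl : ends (z * b) c^-1.
    split; rewrite ?memSV // invgK -mulgA -gE; apply/eqP; rewrite eqn_leq.
    have := len_mulr_ge (z * b) cS; rewrite -mulgA -gE => -> /=.
    by apply: leq_trans zb3; apply: leq_ltn_trans lz.
  rewrite [LHS]gE; congr (_ * _); rewrite /f; case: pickP => [x /andP[xS /eqP Ex]|no] /=.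
    by rewrite (ends_uniq (g := z * b) (a := x) (b := c^-1)) ?invgK.
  by case: cl => cVS E; have := no c^-1; rewrite cVS -E eqxx.
apply: leq_ltn_trans (subset_leq_card sub) _.
rewrite cardsU1; apply: leq_ltn_trans (leq_add (leq_b1 _) (leq_card_setU _ _)) _.
have := leq_imset_card (fun c => a^-1 * c) (S :\ a).
have := leq_imset_card (fun b => b * f b) (S :\ a^-1).
have := cardsD1 a S; have := cardsD1 a^-1 S; rewrite aS aVS /= => ->.
set I1 := imset _ _; set I2 := imset _ _; move: #|I1| #|I2| #|_| #|_| => n1 n2 n3 n4; lia.
Qed.

(** Each ball added meets each earlier one in at most [(2 * #|S|).-1] points, by the overlap bound
    for the central quotient of their centers. *)
Lemma ball2_translates (s : seq gT) : uniq s ->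
  {in s, forall z, z \in 'Z([set: gT])} ->
  (forall z, z \in 'Z([set: gT]) -> z != 1 -> 2 < len z) ->
  (size s * #|ball2 1%g| <=
    #|\bigcup_(z <- s) ball2 z| + 'C(size s, 2) * (2 * #|S|).-1)%N.
Proof.
move=> + + long; elim: s => [|z s IH] /= => [|/andP[zs us]] sZ; first by rewrite mul0n.
have {}IH := IH us (fun y ys => sZ y (mem_behead (s := z :: s) ys)).
rewrite big_cons; set U := \bigcup_(_ <- _) _ in IH *.
have cap : #|ball2 z :&: U| <= (size s * (2 * #|S|).-1)%N.
  have : {in s, forall y, #|ball2 z :&: ball2 y| <= (2 * #|S|)%N.-1}.
    move=> y ys; have yZ : y \in 'Z([set: gT]) by apply: sZ; rewrite inE ys orbT.
    have wZ : y^-1 * z \in 'Z([set: gT]) by rewrite groupM ?groupV // sZ ?mem_head.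
    have nw1 : y^-1 * z != 1.
      by apply: contraNneq zs => /eqP; rewrite -eq_mulVg1 => /eqP <-.
    have lt := ball2_overlap_lt wZ (long _ wZ nw1).
    rewrite -ltnS (ltn_predK lt); apply: leq_ltn_trans lt.
    rewrite -(card_imset (ball2 z :&: ball2 y) (mulgI z^-1)).
    apply: subset_leq_card; apply/subsetP => _ /imsetP[g /setIP[gz gy] ->].
    by move: gz gy; rewrite !inE => -> /=; rewrite -mulgA mulKVg.
  rewrite /U {U us IH zs sZ}; elim: s => [|y s' IHs] bound; first by rewrite big_nil setI0 cards0.
  rewrite big_cons setIUr; apply: leq_trans (leq_card_setU _ _) _.
  rewrite mulSn leq_add ?bound ?mem_head //.
  by apply: IHs => x xs; apply: bound; rewrite inE xs orbT.
have := cardsUI (ball2 z) U; rewrite card_ball2 binS bin1 mulSn mulnDl.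
move: IH cap; move: (size s * _)%N (size s * _)%N ('C(_, _) * _)%N => p q r.
move: #|ball2 1| #|U| #|ball2 z :|: U| #|ball2 z :&: U| => n1 n2 n3 n4; lia.
Qed.

(** The clique of [x] together with [1] has [kappa x + 1] points. A branching vertex has one
    neighbor for each, in distinct cliques, and is translated to [1]. *)
Lemma local_clique_lt_num x : 1 < m -> x \in S -> kappa x < m.
Proof.
move=> m1 xS; have gsym := cayley_sym; have girr := cayley_irr.
have eS y : (cayley S 1 y) = (y \in S) by rewrite cayleyE invg1 mul1g.
have e1x : cayley S 1 x by rewrite eS.
set L := local_clique (cayley S) 1 x.
have clK := local_clique_closed gm gsym girr e1x; rewrite -/L in clK.
have n1L : 1 \notin L by rewrite inE cayley_nbhd1 (negbTE S1).
have xL : x \in L by rewrite inE cayley_nbhd1 xS eqxx.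
have [/existsP[u /andP[uS uL]]|/existsPn no] := boolP [exists u, (u \in S) && (u \notin L)];
  last first.
  suff : m <= #|[set x]| by rewrite cards1 leqNgt m1.
  apply: (num_cliques_le_cover gm gsym girr) => y; rewrite eS => yS.
  by exists x; [rewrite eS xS inE eqxx | have := no y; rewrite yS negbK].
have uK : u \notin 1 |: L by rewrite in_setU1 negb_or uL andbT; apply: contraNneq S1 => <-.
(* No distance exceeds the maximal length, so the distance to [o] is largest at [1]. *)
pose o := [arg max_(g > 1 | true) len g].
have maxo y : d y o <= d 1 o.
  by rewrite distE /o; case: arg_maxnP => // o' _; apply.
have x1 : x != 1 by apply: contraNneq S1 => <-.
have in1 : 1 \in 1 |: L by rewrite setU11.
have inx : x \in 1 |: L by rewrite in_setU1 xL orbT.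
have eqd := equidistant_exists gm gsym girr clK in1 inx x1 maxo (etrans (eS u) uS) uK.
have [v [w [evw indep]]] := equidistant_branching gm gsym girr clK inx in1 x1 eqd.
have : #|1%g |: L| <= m.
  apply: (independent_le_cliques gm gsym girr (w := fun y => v^-1 * w y)).
    by move=> k /evw; rewrite !cayleyE invg1 mul1g.
  move=> k k' kK k'K nk; have [nw ne] := indep k k' kK k'K nk.
  by rewrite (inj_eq (mulgI _)) nw cayley_mull.
by rewrite cardsU1 n1L.
Qed.

(** If [a] were central, a generator [y] with [a * y] of length 2 would equal [a] by
    [commute_len_up]; all others lie in the clique of [a^-1], leaving at most two cliques. *)
Lemma gen_not_central a : 2 < m -> a \in S -> a \notin 'Z([set: gT]).
Proof.
move=> m2 aS; apply/negP => aZ; have gsym := cayley_sym; have girr := cayley_irr.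
have card2 : #|[set a; a^-1]| <= 2 by rewrite cards2; case: (_ != _).
suff : m <= #|[set a; a^-1]| by move/leq_trans/(_ card2); rewrite leqNgt m2.
apply: (num_cliques_le_cover gm gsym girr) => y; rewrite cayleyE invg1 mul1g => yS.
have [ya|ya] := eqVneq y a.
  by exists a; rewrite ?inE ?cayleyE ?invg1 ?mul1g ?ya ?aS ?eqxx.
exists a^-1; first by rewrite !inE cayleyE invg1 mul1g memSV aS eqxx orbT.
rewrite mem_local_clique // leqNgt; apply: contra ya => la.
have l2 : len (a * y) = (len a).+1.
  have := len_mulr a yS; rewrite (len_gen aS) => le.
  by apply/eqP; rewrite eqn_leq le la.
have := commute_len_up yS (central_commute y aZ) l2.
by rewrite (len_gen aS) expg1 => ->.
Qed.

(** [K] is the sum of squared clique sizes and [B] the size of a ball of radius 2. The last bound is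
    doubled because [z0 * z0.-1] is twice ['C(z0, 2)]. *)
Lemma central_count_bound (z0 : nat) : 2 < m -> z0 <= #|'Z([set: gT])| ->
  exists K B : nat, [/\ (1 + #|S| + #|S| * #|S| <= B + K)%N,
    (K + m * m.-1 <= m * #|S|)%N &
    (2 * z0 * B + z0 * z0.-1 <= 2 * #|gT| + z0 * z0.-1 * (2 * #|S|))%N].
Proof.
move=> m2 z0Z; exists (\sum_(x in S) kappa x), #|ball2 1|; split.
- exact: card_ball2_ge.
- have NS : neighborhood (cayley S) 1 = S by apply/setP => x; rewrite cayley_nbhd1.
  have := sum_local_clique_bound gm cayley_sym cayley_irr (v := 1) (ltnW (ltnW m2)).
  rewrite NS; apply=> x; rewrite cayleyE invg1 mul1g => xS.
  by apply: local_clique_lt_num; first exact: ltnW.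
pose s := take z0 (enum 'Z([set: gT])).
have szs : size s = z0 by rewrite size_takel -?cardE.
have sZ : {in s, forall z, z \in 'Z([set: gT])}.
  by move=> z /mem_take; rewrite mem_enum.
have noZ a := @gen_not_central a m2.
have := ball2_translates (take_uniq z0 (enum_uniq 'Z([set: gT]))) sZ
  (fun z zZ => central_len_ge3 noZ zZ).
rewrite -/s szs => le.
have Sgt0 : 0 < #|S|.
  rewrite lt0n cards_eq0; apply: contraTneq m2 => S0; rewrite -leqNgt.
  suff : m <= #|@set0 gT| by rewrite cards0 => /leq_trans; apply.
  apply: (num_cliques_le_cover gm cayley_sym cayley_irr) => y.
  by rewrite cayleyE S0 inE.
have leU : (z0 * #|ball2 1%g| <= #|gT| + 'C(z0, 2) * (2 * #|S|).-1)%N.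
  by apply: leq_trans le (leq_add (max_card _) (leqnn _)).
have ff : (z0 * z0.-1 = 'C(z0, 2) * 2)%N by rewrite (bin_ffact z0 2) ffactnS ffactn1.
rewrite ff -mulnA -(@prednK (2 * #|S|)%N) ?muln_gt0 //; move: leU.
move: (z0 * #|ball2 1%g|)%N (2 * #|S|)%N.-1 => p q; nia.
Qed.

End Cayley.

(** * Rational arithmetic and conclusion *)

Local Open Scope ring_scope.

Lemma combine_count_bounds (m0 m z0 s N K B : nat) :
  (3 <= m0 <= m)%N ->
  (1 + s + s * s <= B + K)%N -> (K + m * m.-1 <= m * s)%N ->
  (2 * z0 * B + z0 * z0.-1 <= 2 * N + z0 * z0.-1 * (2 * s))%N ->
  1 / 2 * ((3 * m0%:R - 4) / (2 * m0%:R - 2)) * z0%:R * s%:R ^+ 2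
    - z0%:R * (z0%:R - 2) * s%:R + 1 / 2 * z0%:R * (z0%:R + 1) <= N%:R :> rat.
Proof.
move=> /andP[m03 m0m].
have [p m0E] : exists p, m0 = p.+1 by exists m0.-1; rewrite (ltn_predK m03).
have [q mE] : exists q, m = q.+1.
  by exists m.-1; rewrite (ltn_predK (leq_trans m03 m0m)).
rewrite {}m0E {}mE in m03 m0m * => hB hK hz.
have p2 : (2 <= p)%N := m03; have pq : (p <= q)%N := m0m; pose r : rat := s%:R.
case: z0 hz => [_|t hz].
  by rewrite !(mulr0, mul0r) subr0 addr0 ler0n.
rewrite /= in hK hz.
have hB' : 1 + r + r * r <= B%:R + K%:R.
  by have := hB; rewrite -(ler_nat rat) !natrD natrM.
have hK' : K%:R + (q%:R + 1) * q%:R <= (q%:R + 1) * r.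
  by have := hK; rewrite -(ler_nat rat) natrD !natrM -[q.+1%:R]natr1.
have hz' : 2 * (t%:R + 1) * B%:R + (t%:R + 1) * t%:R <=
    2 * N%:R + (t%:R + 1) * t%:R * (2 * r).
  have := hz; rewrite -(ler_nat rat) (natrD _ (2 * t.+1 * B)) (natrD _ (2 * N)).
  by rewrite !natrM -[t.+1%:R]natr1.
have p2' : 2 <= p%:R :> rat by rewrite (ler_nat rat 2).
have pq' : p%:R <= q%:R :> rat by rewrite ler_nat.
rewrite -/r -[p.+1%:R]natr1 -[t.+1%:R]natr1.
move: hB' hK' hz' p2' pq'.
have t0 : 0 <= t%:R :> rat by rewrite ler0n.
move: (p%:R : rat) (q%:R : rat) (t%:R : rat) t0 (K%:R : rat) (B%:R : rat) (N%:R : rat).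
move: r; clear => r P Q t t0 K B N hB hK hz P2 PQ.
have Q0 : 0 < Q by lra.
have P0 : 0 < P by lra.
(* With [Q] one less than the number of cliques, completing the square removes the term linear in
   [r]. *)
have sqQ : 4 * Q * K <= (Q + 1) * r ^+ 2.
  have : 0 <= (Q + 1) * (r - 2 * Q) ^+ 2 by rewrite mulr_ge0 ?sqr_ge0; lra.
  have : 4 * Q * (K + (Q + 1) * Q) <= 4 * Q * ((Q + 1) * r).
    by rewrite ler_pM2l; [exact: hK | lra].
  nra.
have KQ : K <= (1 + Q^-1) * r ^+ 2 / 4.
  rewrite -(ler_pM2l (_ : 0 < 4 * Q)); last by lra.
  apply: le_trans sqQ _; rewrite le_eqVlt; apply/orP; left; apply/eqP.
  by field; lra.
(* The bound decreases as [Q] grows, so [m] may be replaced by [m0]. *)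
have KP : K <= (1 + P^-1) * r ^+ 2 / 4.
  have le : Q^-1 <= P^-1 by rewrite lef_pV2 ?posrE.
  apply: le_trans KQ _; rewrite ler_wpM2r // ler_wpM2r ?sqr_ge0 //.
  by rewrite lerD2l.
(* Half of [alpha0] is the coefficient of [r ^+ 2] left after subtracting the bound on [K]. *)
have alphaE : 1 / 2 * ((3 * (P + 1) - 4) / (2 * (P + 1) - 2)) =
    1 - (1 + P^-1) / 4 by field; lra.
rewrite alphaE.
have : (t + 1) * (1 + r + r ^+ 2 - (1 + P^-1) * r ^+ 2 / 4) <= (t + 1) * B.
  by apply: ler_wpM2l; [lra | rewrite expr2 in KP *; lra].
move: (P^-1) => u; rewrite expr2; lra.
Qed.

Theorem theorem4p7 (gT : finGroupType) (S : {set gT})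
    (S1 : 1%g \notin S) (SV : (S^-1)%g = S) (Sgen : <<S>>%g = [set: gT])
    (geo : geodetic (cayley S))
    (ncomplete : ~ complete_graph (cayley S))
    (noddcycle : ~ odd_cycle_graph (cayley S))
    (z0 m0 : nat)
    (hz0 : (1 <= z0 <= #|'Z([set: gT])%g|)%N)
    (hm0 : (3 <= m0 <= num_cliques_at (cayley S) 1%g)%N) :
  let alpha0 : rat := (3 * m0%:R - 4) / (2 * m0%:R - 2) in
  let z : rat := z0%:R in
  let s : rat := #|S|%:R in
  1 / 2 * alpha0 * z * s ^+ 2 - z * (z - 2) * s + 1 / 2 * z * (z + 1)
    <= #|gT|%:R.
Proof.
have [d gm] := geodetic_metric_exists geo.
case/andP: hz0 => _ zZ; have /andP[m3 mm] := hm0.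
have [K [B [hB hK hz]]] := central_count_bound S1 SV gm (leq_trans m3 mm) zZ.
exact: combine_count_bounds hm0 hB hK hz.
Qed.
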